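(* Let $\Gamma$ and $\Lambda$ be two finitely generated groups and fix finite generating systems $S_\Gamma$ of $\Gamma$ and $S_\Lambda$ of $\Lambda$. Then $\Gamma$ and $\Lambda$ admit p.m.p. essentially free actions that are isometric orbit equivalent (with respect to $S_\Gamma$ and $S_\Lambda$) if and only if the Cayley graphs $(\Gamma,S_\Gamma)$ and $(\Lambda,S_\Lambda)$ are isometric.
   Context: A finite generating system of a group is a finite symmetric generating set not containing the identity. A p.m.p. action $\Gamma\curvearrowright^\alpha(X,\mu)$ on a standard probability space is an action of $\Gamma$ by bimeasurable bijections $\alpha(\gamma)$ of $X$ preserving the probability measure $\mu$. It is essentially free if the set of points with trivial stabilizer has full measure. Cayley graph: $(\Gamma,S_\Gamma)$ is the graph with vertex set $\Gamma$ and edges $\{\gamma,\gamma s\}$ for $\gamma\in\Gamma$, $s\in S_\Gamma$, endowed with the graph distance. Two Cayley graphs $(\Gamma,S_\Gamma)$ and $(\Lambda,S_\Lambda)$ are isometric if there is a bijection $\Gamma\to\Lambda$ that is an isometry for the graph distances. Isometric orbit equivalence: for a p.m.p. action $\alpha$ of $\Gamma$ on $(X,\mu)$, let $d_{\alpha(S_\Gamma)}(x,x')\in\mathbb{N}\cup\{+\infty\}$ be the graph distance on the graph with vertex set $X$ and edge set $\{(x,x')\in X\times X : \exists s\in S_\Gamma,\ \alpha(s)x=x'\}$ (equal to $+\infty$ if $x,x'$ lie in different connected components). Two p.m.p. actions $\Gamma\curvearrowright^\alpha(X,\mu)$ and $\Lambda\curvearrowright^\beta(Y,\nu)$ are isometric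 orbit equivalent if there exist a bimeasurable bijection $\Phi:X\to Y$ with $\Phi_*\mu=\nu$ and a $\Gamma$-invariant measurable set $X_0\subseteq X$ with $\mu(X_0)=1$ such that $\Phi(X_0)$ is $\Lambda$-invariant and $d_{\beta(S_\Lambda)}(\Phi(x),\Phi(x'))=d_{\alpha(S_\Gamma)}(x,x')$ for all $x,x'\in X_0$. *)

(* Defs.v *)
From HB Require Import structures.
From mathcomp Require Import all_boot all_order all_algebra.
From mathcomp Require Import all_classical all_reals all_analysis.

Set Implicit Arguments.
Unset Strict Implicit.
Unset Printing Implicit Defensive.

Import Order.TTheory GRing.Theory Num.Theory.

Local Open Scope classical_set_scope.
Local Open Scope group_scope.

(* [groupType] is the structure of possibly infinite groups. *)

Section Groups.
Context {G : groupType}.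

Definition subgroup (H : set G) : Prop :=
  [/\ H 1, (forall x y, H x -> H y -> H (x * y))
    & (forall x, H x -> H x^-1)].

Definition generated (S : set G) : set G := smallest subgroup S.

Record finite_generating_system (S : set G) : Prop := {
  fgs_finite : finite_set S;
  fgs_symmetric : forall s, S s -> S s^-1;
  fgs_not1 : ~ S 1;
  fgs_generates : generated S = setT }.

End Groups.

(* The infimum of the lengths of the edge paths from [x] to [y]; it is
   [+oo] exactly when there is no such path, as [ereal_inf set0 = +oo]. *)
Definition graph_dist {R : realType} {V : Type} (E : V -> V -> Prop)
    (x y : V) : \bar R :=
  ereal_inf [set ((size p)%:R)%:E | p in
    [set p : seq V | path (fun u v => `[< E u v >]) x p /\ last x p = y]].

(* The two edge relations below are symmetric whenever [S] is, so that they
   describe undirected graphs. *)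
Definition cayley_edge {G : groupType} (S : set G) (g h : G) : Prop :=
  exists2 s, S s & h = g * s.

Definition orbit_edge {G : groupType} {X : Type} (S : set G)
    (alpha : G -> X -> X) (x y : X) : Prop :=
  exists2 s, S s & alpha s x = y.

Definition cayley_dist {R : realType} {G : groupType} (S : set G) :
  G -> G -> \bar R := graph_dist (cayley_edge S).

Definition orbit_dist {R : realType} {G : groupType} {X : Type} (S : set G)
  (alpha : G -> X -> X) : X -> X -> \bar R := graph_dist (orbit_edge S alpha).

Definition isometric_cayley_graphs (R : realType) {G L : groupType}
    (SG : set G) (SL : set L) : Prop :=
  exists f : G -> L, bijective f /\
    forall g h, cayley_dist SL (f g) (f h) = cayley_dist SG g h :> \bar R.

(* [X] is isomorphic, as a measurable space, to a Polish space (a separable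
   complete metric space) endowed with its Borel sigma-algebra.  Atoms are
   allowed for the measures on [X], since a finite group may act. *)
Definition standard_borel (R : realType) d (X : measurableType d) : Prop :=
  exists M : metricType R,
    [/\ (forall u : nat -> M, cauchy (u @ \oo) -> exists l : M, u @ \oo --> l),
        (exists2 D : set M, countable D & dense D)
      & exists2 f : X -> M, bijective f &
          @measurable d X = preimage_set_system setT f <<s @open M >>].

(* The inverse of [alpha g] is [alpha g^-1], so each [alpha g] is
   automatically a bimeasurable bijection. *)
Record pmp_action {R : realType} d {X : measurableType d} {G : groupType}
    (mu : probability X R) (alpha : G -> X -> X) : Prop := {
  pmp_act1 : forall x, alpha 1 x = x;
  pmp_actM : forall g h x, alpha (g * h) x = alpha g (alpha h x);
  pmp_measurable : forall g, measurable_fun setT (alpha g);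
  pmp_preserving : forall g A, measurable A -> mu (alpha g @^-1` A) = mu A }.

Definition stabilizer {X : Type} {G : groupType} (alpha : G -> X -> X)
  (x : X) : set G := [set g | alpha g x = x].

Definition essentially_free {R : realType} d {X : measurableType d}
    {G : groupType} (mu : probability X R) (alpha : G -> X -> X) : Prop :=
  {ae mu, forall x, stabilizer alpha x = [set 1]}.

Definition invariant_set {X : Type} {G : groupType} (alpha : G -> X -> X)
  (A : set X) : Prop := forall g, alpha g @` A = A.

Definition isometric_orbit_equivalent {R : realType} dX dY
    {X : measurableType dX} {Y : measurableType dY} {G L : groupType}
    (SG : set G) (SL : set L) (mu : probability X R) (nu : probability Y R)
    (alpha : G -> X -> X) (beta : L -> Y -> Y) : Prop :=
  exists (Phi : X -> Y) (Psi : Y -> X) (X0 : set X),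
  [/\ cancel Phi Psi /\ cancel Psi Phi,
      measurable_fun setT Phi /\ measurable_fun setT Psi,
      (forall B, measurable B -> pushforward mu Phi B = nu B),
      [/\ measurable X0, mu X0 = 1%E, invariant_set alpha X0
        & invariant_set beta (Phi @` X0)]
    & forall x x', X0 x -> X0 x' ->
        orbit_dist SL beta (Phi x) (Phi x') = orbit_dist SG alpha x x'
          :> \bar R].

(* Main.v *)
From HB Require Import structures.
Require Import Defs.
From mathcomp Require Import all_boot all_order all_algebra.
From mathcomp Require Import all_classical all_reals all_analysis.

(** Orbit equivalence gives an isometry pointwise.  For a point [x] of [X0] with
    trivial stabilizer, [g |-> alpha g^-1 x] is an isometry of the Cayley graph
    onto the component of [x] in the orbit graph ([orbit_map_dist]); the
    inverse turns the left action of the group into the right translations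
    along which Cayley edges run.  Almost every [x] is such that [x] and
    [Phi x] are both free, and then [Phi], read through the two orbit maps, is
    an isometry of Cayley graphs ([orbit_equivalent_isometric]).

    Conversely, suppose that the Cayley graphs are isometric.  Both actions live
    on the space [X] of pairs [(f, c)] where [f] is a graph isomorphism from
    [Gamma] to [Lambda] with [f 1 = 1], and [c] attaches an infinite sequence of
    bits to each vertex.  Moving the root to [g] replaces [f] by
    [h |-> (f g)^-1 f (g h)] and [c] by [h |-> c (g h)].  The group [Gamma]
    acts by moving the root to [gamma^-1], the group [Lambda] by moving it to
    [f^-1 (lambda^-1)].  Since [f] maps generators to generators, the edges of
    the two orbit graphs are the same pairs of points, so that the identity of
    [X] is an isometric orbit equivalence.

    The measure has to be invariant under moving the root.  Two points agree at
    level [n] when they have the same restriction to the ball of radius [n] (and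
    the same first [n] bits there).  This makes [X] a profinite space on which
    the automorphisms of the [Lambda] graph fixing [1] and the changes of bits
    act transitively, preserving all levels.  Hence there is exactly one
    probability measure that gives the same mass to all classes of each level
    ([exists_uniform], [tower_measure_unique]): a Haar measure, obtained here
    from Lebesgue measure on the unit interval by mixed radix expansion.  By the
    same symmetries, for each finite set [F] of vertices all classes of the
    relation of agreement on [F] have the same mass ([agree_on_measure]).  For
    large [n], the preimage of a class of level [n] under moving the root to [g]
    is a class of agreement on the translate by [g] of the ball
    ([agree_on_reroot]): therefore the image measure is uniform too, and it is
    the same measure ([reroot_preserved]).
    This is how unimodularity of the automorphism group of the graph, which
    contains [Gamma] as a lattice, enters the argument.  The action of [Lambda]
    is, locally, a move of the root to a constant vertex ([target_preserved]).

    A point fixed by moving the root to some [g <> 1] carries the same bits at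
    [g] and at [1], which almost no point does ([reroot_free]); so both actions
    are essentially free. *)

Set Implicit Arguments.
Unset Strict Implicit.
Unset Printing Implicit Defensive.

Import Order.TTheory GRing.Theory Num.Theory.

Local Open Scope classical_set_scope.

(** * Homogeneous profinite spaces *)

(** [agree n x y] says that [x] and [y] are in the same class of the [n]-th of a
    sequence of finer and finer finite partitions.  The conditions make [X] the
    inverse limit of the finite sets of classes, and [agree_hom] says that the
    group of its level-preserving bijections is transitive. *)
Record homogeneous_tower (X : Type) (agree : nat -> X -> set X) : Prop := {
  agree_refl : forall n x, agree n x x;
  agree_sym : forall n x y, agree n x y -> agree n y x;
  agree_trans : forall n y x z, agree n x y -> agree n y z -> agree n x z;
  agree0 : forall x y, agree 0 x y;
  agreeS : forall n x y, agree n.+1 x y -> agree n x y;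
  agree_sep : forall x y, (forall n, agree n x y) -> x = y;
  agree_lim : forall u : nat -> X,
    (forall m n, (m <= n)%N -> agree m (u m) (u n)) ->
    exists x, forall n, agree n (u n) x;
  agree_fin : forall n, finite_set (range (agree n));
  agree_hom : forall x y, exists A : X -> X,
    [/\ A x = y, (forall z, exists w, A w = z)
      & forall n z w, agree n (A z) (A w) <-> agree n z w] }.

Definition cylinders (X : Type) (agree : nat -> X -> set X) : set (set X) :=
  [set C | exists n x, C = agree n x].

Section Tower.
Context (X : pointedType) (agree : nat -> X -> set X).
Hypothesis tower : homogeneous_tower agree.

Local Notation T := (g_sigma_algebraType (cylinders agree)).

Lemma agree_classE n x y : agree n x = agree n y <-> agree n x y.
Proof.
split=> [->|xy]; first exact: agree_refl.
apply/seteqP; split=> z; first exact/(agree_trans tower)/(agree_sym tower).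
exact: (agree_trans tower).
Qed.

Lemma agree_le m n x y : (m <= n)%N -> agree n x y -> agree m x y.
Proof.
elim: n => [|n IH]; first by rewrite leqn0 => /eqP ->.
rewrite leq_eqVlt => /orP[/eqP -> //|]; rewrite ltnS => mn.
by move/(agreeS tower); exact: IH.
Qed.

Lemma tower_limit (u : nat -> X) :
  (forall n, agree n (u n) (u n.+1)) -> exists x, forall n, agree n (u n) x.
Proof.
move=> uP; apply: agree_lim tower _ _ => m n /subnKC <-.
elim: (n - m)%N => [|k IH]; first by rewrite addn0; exact: agree_refl.
apply: (agree_trans tower) IH _; rewrite addnS.
exact: agree_le (leq_addr _ _) (uP _).
Qed.

(** Only finitely many classes occur in this union, which makes such a set
    measurable, and its measure a finite sum. *)
Lemma saturated_bigcup n (A : set X) :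
  (forall x y, agree n x y -> A x -> A y) ->
  A = \bigcup_(C in range (agree n) `&` [set C | C `<=` A]) C.
Proof.
move=> sA; apply/seteqP; split=> [x Ax|x [C [_ CA] Cx]]; last exact: CA.
exists (agree n x); last exact: (agree_refl tower).
split; first by exists x.
by move=> y xy; exact: sA Ax.
Qed.

Lemma measurable_class n x : measurable (agree n x : set T).
Proof. by apply: sub_sigma_algebra; exists n, x. Qed.

Lemma measurable_saturated n (A : set T) :
  (forall x y, agree n x y -> A x -> A y) -> measurable A.
Proof.
move=> /saturated_bigcup ->; apply: fin_bigcup_measurable.
  exact: sub_finite_set (@subIsetl _ _ _) (agree_fin tower n).
by move=> _ [[x _ <-] _]; exact: measurable_class.
Qed.

(** * Mixed radix digits *)

(** All classes of level [n] split into the same number [b] of classes of level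
    [n.+1], because a symmetry carries any of them to the class of the base
    point. The rank of a subclass is defined there, and transported. *)
Lemma exists_digit n : exists (b : nat) (rk : X -> nat),
  [/\ forall x, (rk x < b)%N,
      forall x y, agree n x y -> (rk x = rk y <-> agree n.+1 x y)
    & forall x k, (k < b)%N -> exists2 y, agree n x y & rk y = k].
Proof.
pose D := agree n.+1 @` agree n point.
have /finite_seqP[s sD] : finite_set D.
  apply: sub_finite_set (agree_fin tower n.+1).
  by move=> _ [x _ <-]; exists x.
have [A AP] := choice (agree_hom tower ^~ point).
(* The symmetry [A (rep x)] depends only on the class of [x]: with one symmetry
   for each point, the ranks within a class would not be comparable. *)
pose rep x := get (agree n x).
have repP x : agree n x (rep x).
  by rewrite /rep; apply: getPex; exists x; exact: agree_refl.
have repE x y : agree n x y -> rep x = rep y.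
  by move=> xy; congr get; apply/agree_classE.
have in_s x y : rep x = rep y -> agree n (rep x) y ->
    agree n.+1 (A (rep x) y) \in undup s.
  move=> rxy ry; rewrite mem_undup.
  suff : [set` s] (agree n.+1 (A (rep x) y)) by [].
  rewrite -sD; exists (A (rep x) y) => //.
  by have [<- _ ->] := AP (rep x).
exists (size (undup s)), (fun x => index (agree n.+1 (A (rep x) x)) (undup s)).
have ins x : agree n.+1 (A (rep x) x) \in undup s.
  by apply: in_s => //; apply: (agree_sym tower).
split=> [x|x y xy|x k ks].
- by rewrite index_mem.
- have rxy := repE _ _ xy; rewrite -rxy; have [_ _ Ah] := AP (rep x).
  rewrite -Ah -agree_classE; split=> [/(congr1 (nth set0 (undup s)))|-> //].
  by rewrite !nth_index// in_s// rxy; apply: agree_sym tower _ _ _ (repP y).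
- have : nth set0 (undup s) k \in undup s by rewrite mem_nth.
  rewrite mem_undup => ks'; have : [set` s] (nth set0 (undup s) k) by [].
  rewrite -sD => -[w pw wE]; have [Ar As Ah] := AP (rep x).
  have [y yw] := As w; have ry : agree n (rep x) y by rewrite -Ah Ar yw.
  have xy := agree_trans tower (repP x) ry.
  exists y => //.
  by rewrite -(repE _ _ xy) yw wE index_uniq ?undup_uniq.
Qed.

(** The [n]-th code is a number written with [n] digits in the mixed radix given
    by the [b i]; dividing by [b n] drops the last digit. *)
Lemma exists_codes : exists (N b : nat -> nat) (e : nat -> X -> nat),
  [/\ N 0 = 1%N /\ (forall n, N n.+1 = (N n * b n)%N),
      forall n x, (e n x < N n)%N,
      forall n x y, e n x = e n y <-> agree n x y,
      forall n k, (k < N n)%N -> exists x, e n x = k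
    & forall n x, (e n.+1 x %/ b n)%N = e n x].
Proof.
have [b bP] := choice exists_digit; have [rk rkP] := choice bP.
pose N n := (\prod_(i < n) b i)%N.
pose e := fix e n x := if n is m.+1 then (e m x * b m + rk m x)%N else 0%N.
have eD n x : (e n.+1 x %/ b n)%N = e n x.
  have [rb _ _] := rkP n.
  by rewrite /= divnMDl ?divn_small ?addn0// (leq_trans _ (rb x)).
have eE n x y : e n x = e n y <-> agree n x y.
  elim: n x y => [|n IH] x y; first by split=> // _; exact: (agree0 tower).
  have [_ rE _] := rkP n; split=> [exy|xy].
    have en : e n x = e n y by rewrite -(eD n x) exy eD.
    apply/rE; first exact/IH.
    by move: exy; rewrite /= en => /addnI.
  have xyn := agreeS tower xy.
  by rewrite /=; have -> := (IH x y).2 xyn; congr addn; apply/rE.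
exists N, b, e; split=> //.
- by split=> [|n]; rewrite /N ?big_ord0 ?big_ord_recr.
- elim=> [|n IH] x; first by rewrite /N big_ord0.
  have [rb _ _] := rkP n; rewrite /N big_ord_recr /= -/(N n).
  apply: (@leq_trans (e n x * b n + b n)); first by rewrite -addnS leq_add2l.
  by rewrite -mulSnr leq_mul2r IH orbT.
- elim=> [k|n IH k].
    by rewrite /N big_ord0 ltnS leqn0 => /eqP ->; exists point.
  rewrite /N big_ord_recr /= -/(N n) => kN; have [_ _ rS] := rkP n.
  have b0 : (0 < b n)%N by move: kN; case: (b n) => //; rewrite muln0.
  have [x xE] := IH (k %/ b n)%N ltac:(by rewrite ltn_divLR).
  have [y xy yE] := rS x (k %% b n)%N (ltn_pmod _ b0).
  by exists y; rewrite /= yE -((eE n x y).2 xy) xE -divn_eq.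
Qed.

(** The digits of a real number in mixed radix: the integer parts of [u * N n]
    are the codes of a decreasing sequence of classes, whose common point is
    [phi u]. *)
Lemma exists_sampling (R : realType) :
  exists (N : nat -> nat) (e : nat -> X -> nat) (phi : R -> X),
  [/\ forall n, (0 < N n)%N, forall n x y, e n x = e n y <-> agree n x y,
    forall n x, (e n x < N n)%N
    & forall n (u : R), 0 <= u < 1 ->
        e n (phi u) = Num.truncn (u * (N n)%:R)]%R.
Proof.
have [N [b [e [[N0 NS] eN eE eS eD]]]] := exists_codes.
have Ngt0 n : (0 < N n)%N by exact: leq_trans (eN n point).
have phiP (u : R) : exists x, (0 <= u < 1)%R ->
    forall n, e n x = Num.truncn (u * (N n)%:R)%R.
  have [/andP[u0 u1]|_] := boolP (0 <= u < 1)%R; last by exists point.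
  have pos n : (0 <= u * (N n)%:R)%R by rewrite mulr_ge0.
  have tN n : (Num.truncn (u * (N n)%:R)%R < N n)%N.
    rewrite -(ltr_nat R); apply: le_lt_trans (_ : (u * (N n)%:R < _)%R).
      by rewrite truncn_le.
    by rewrite gtr_pMl// ltr0n.
  have [x xP] := choice (fun n => eS n _ (tN n)).
  have [|y yP] := tower_limit (u := x).
    (* The integer part of [v * b], divided by [b], is that of [v]. *)
    move=> n; apply/eE; rewrite -(eD n (x n.+1)) !xP.
    apply/eqP; rewrite truncn_eq//.
    have b0 : (0 < b n)%N by have := Ngt0 n.+1; rewrite NS muln_gt0 => /andP[].
    set k := Num.truncn _; have /andP[k1 k2] := truncn_itv (pos n.+1).
    rewrite -/k NS natrM mulrA in k1 k2.
    have b0' : (0 < (b n)%:R :> R)%R by rewrite ltr0n.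
    rewrite -(ler_pM2r b0') -(ltr_pM2r b0') -!natrM.
    rewrite (le_trans _ k1) ?ler_nat ?leq_trunc_div//=.
    by rewrite (lt_le_trans k2)// ler_nat ltn_ceil.
  by exists y => _ n; rewrite -xP; apply/esym/eE.
have [phi phiE] := choice phiP.
exists N, e, phi; split=> // n u u01.
exact: phiE.
Qed.

End Tower.

(** * The uniform measure *)

Lemma probability_image d d' (T1 : measurableType d) (T2 : measurableType d')
    (R : realType) (P : probability T1 R) (f : T1 -> T2) :
  measurable_fun setT f ->
  exists Q : probability T2 R, forall A, Q A = P (f @^-1` A).
Proof.
move=> mf.
pose F : {mfun T1 >-> T2} := HB.pack f (isMeasurableFun.Build _ _ _ _ f mf).
by exists (distribution P F).
Qed.

Section UniformMeasure.
Context (X : pointedType) (agree : nat -> X -> set X).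
Hypothesis tower : homogeneous_tower agree.
Local Notation T := (g_sigma_algebraType (cylinders agree)).
Context (R : realType).

(** The measure does not depend on [P], since it is the inverse of the number of
    classes. *)
Lemma class_measure n : exists N : nat, forall P : probability T R,
  (forall x y, P (agree n x) = P (agree n y)) ->
  forall x, P (agree n x) = ((N%:R)^-1)%:E.
Proof.
have [N [_ [e [_ eN eE eS _]]]] := exists_codes tower.
exists (N n) => P Pn x0; pose F k : set T := [set x | e n x = k].
have FE x : F (e n x) = agree n x.
  by apply/seteqP; split=> y /= => [/esym/eE|/eE/esym].
have mF k : measurable (F k).
  apply: (@measurable_saturated _ _ tower n) => x y xy.
  by rewrite /F /= => <-; apply/esym/eE.
have PF k : (k < N n)%N -> P (F k) = P (agree n x0).
  by move=> /eS[x <-]; rewrite FE.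
have TF : \big[setU/set0]_(k < N n) F k = [set: T].
  rewrite -subTset => x _; rewrite -bigcup_mkord.
  by exists (e n x) => //=; exact: eN.
have := probability_setT P; rewrite -TF measure_bigsetU//; last first.
  by move=> i j _ _ [x [<- <-]].
rewrite (eq_bigr (fun=> (fine (P (agree n x0)))%:E)) => [|k _]; last first.
  rewrite fineK; first exact: PF.
  by rewrite fin_num_measure//; exact: measurable_class.
rewrite sumEFin sumr_const card_ord => -[] NP.
rewrite -(@fineK _ (P (agree n x0))); last first.
  by rewrite fin_num_measure//; exact: measurable_class.
congr EFin; have {}NP : (fine (P (agree n x0)) * (N n)%:R = 1 :> R)%R.
  by rewrite mulr_natr.
have [N0|N0] := eqVneq ((N n)%:R : R)%R 0%R.
  by move: NP; rewrite N0 mulr0 => /esym/eqP; rewrite oner_eq0.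
by apply: (mulIf N0); rewrite NP mulVf.
Qed.

(** The classes of high level determine the measure of the saturated sets, which
    form a generating algebra.  The threshold [r] is there because a move of the
    root is only understood on levels that are at least its length. *)
Lemma tower_measure_unique (P Q : probability T R) r :
  (forall n x y, (r <= n)%N -> P (agree n x) = P (agree n y)) ->
  (forall n x y, (r <= n)%N -> Q (agree n x) = Q (agree n y)) ->
  forall A, measurable A -> P A = Q A.
Proof.
move=> Pr Qr.
pose G : set (set T) :=
  [set A | exists n, forall x y, agree n x y -> A x -> A y].
have GT : G setT by exists 0.
apply: (@measure_unique _ _ _ G (fun=> setT)) => //.
- rewrite eqEsubset; split; last first.
    apply: smallest_sub; first exact: sigma_algebra_measurable.
    by move=> A [n /(measurable_saturated tower)].
  apply: sub_sigma_algebra2 => _ [n [x ->]]; exists n => y z yz xy.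
  exact: (agree_trans tower) xy yz.
- move=> A B [m mA] [n nB]; exists (maxn m n) => x y xy [Ax Bx]; split.
    exact: mA (agree_le tower (leq_maxl _ _) xy) Ax.
  exact: nB (agree_le tower (leq_maxr _ _) xy) Bx.
- by rewrite bigcup_const.
- move=> A [m mA]; pose n := maxn r m.
  have rn : (r <= n)%N := leq_maxl _ _.
  have nA x y : agree n x y -> A x -> A y.
    by move=> xy; apply: mA; exact: agree_le (leq_maxr _ _) xy.
  have [N NP] := class_measure n.
  rewrite (saturated_bigcup tower nA).
  have finD : finite_set (range (agree n) `&` [set C | C `<=` A]).
    exact: sub_finite_set (@subIsetl _ _ _) (agree_fin tower n).
  have trivD : trivIset (range (agree n) `&` [set C | C `<=` A]) id.
    move=> B C [[x _ <-] _] [[y _ <-] _] [z [xz yz]].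
    apply/(agree_classE tower).
    exact: agree_trans tower _ _ _ _ xz (agree_sym tower yz).
  have mD C : (range (agree n) `&` [set C | C `<=` A]) C ->
      measurable (C : set T).
    by move=> [[x _ <-] _]; exact: measurable_class.
  rewrite !(@measure_fin_bigcup _ _ T _ _ _ id finD trivD mD).
  apply: eq_fsbigr => _ /set_mem[[x _ <-] _].
  transitivity ((N%:R^-1)%:E : \bar R); first by apply: NP => *; exact: Pr.
  by apply/esym/NP => *; exact: Qr.
- by move=> _; exact: le_lt_trans (probability_le1 P measurableT) (ltry 1).
Qed.

(** The image of Lebesgue measure by the sampling map of [exists_sampling]: the
    inverse image of a class of level [n] is an interval of length
    [(N n)%:R^-1]. *)
Lemma exists_uniform : exists mu : probability T R,
  forall n x y, mu (agree n x) = mu (agree n y).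
Proof.
have [N [e [phi [N0 eE eN phiE]]]] := exists_sampling tower R.
pose D : set (measurableTypeR R) := `[0%R, 1%R[.
have DE (u : R) : D u <-> (0 <= u < 1)%R by rewrite /D /= in_itv.
have mD : measurable D by exact: measurable_itv.
(* Nothing is known of the sampling map outside the unit interval [D]. *)
pose phi0 (u : measurableTypeR R) : T := if `[< D u >] then phi u else point.
pose I n k : set (measurableTypeR R) :=
  `[(k%:R / (N n)%:R)%R, (k.+1%:R / (N n)%:R)%R[.
have N0' n : (0 < (N n)%:R :> R)%R by rewrite ltr0n.
have classI n x : phi0 @^-1` (agree n x) `&` D = I n (e n x).
  apply/seteqP; split=> [u [/= xu Du]|u].
    move: xu; rewrite /phi0 asboolT// => /eE; rewrite phiE; last exact/DE.
    move: Du => /DE /andP[u0 _] /esym/eqP; rewrite truncn_eq ?mulr_ge0//.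
    by rewrite /I /= in_itv /= ler_pdivrMr// ltr_pdivlMr.
  rewrite /I /= in_itv /= ler_pdivrMr// ltr_pdivlMr// => xu.
  have Du : D u.
    apply/DE/andP; split; case/andP: xu => x1 x2.
      by rewrite -(pmulr_lge0 _ (N0' n)) (le_trans _ x1).
    rewrite -(ltr_pM2r (N0' n)) mul1r (lt_le_trans x2)// ler_nat.
    exact: eN.
  split=> //; rewrite /phi0 asboolT//; apply/eE/esym.
  rewrite phiE; last exact/DE.
  apply/eqP; rewrite truncn_eq// mulr_ge0//.
  by move/DE: Du => /andP[].
have mI n k : measurable (I n k) by exact: measurable_itv.
have mphi : measurable_fun setT phi0.
  apply: (@measurability _ _ _ T _ phi0 (cylinders agree)) => //.
  move=> _ [_ [n [x ->]] <-].
  rewrite setTI -(setIT (phi0 @^-1` _)) -(setUv D) setIUr classI.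
  apply: measurableU => //; rewrite setIC.
  suff -> : ~` D `&` phi0 @^-1` agree n x =
      ~` D `&` (if `[< agree n x point >] then setT else set0).
    by apply: measurableI; [exact: measurableC|case: ifP].
  apply/seteqP; split=> u /= [nDu]; rewrite /phi0 (@asboolF (D u))//.
    by move=> xp; split=> //; rewrite asboolT.
  by case: asboolP => // xp _; split.
have mD1 : mrestr (@lebesgue_measure R) mD setT = 1%E.
  rewrite /mrestr setTI lebesgue_measure_itv /= lte_fin ltr01.
  by rewrite oppr0 adde0.
pose P : probability (measurableTypeR R) R :=
  HB.pack (mrestr (@lebesgue_measure R) mD)
  (Measure_isProbability.Build _ _ _ (mrestr (@lebesgue_measure R) mD) mD1).
have [mu muE] := probability_image P mphi.
exists mu => n x y; rewrite !muE.
suff PE z : P (phi0 @^-1` agree n z) = ((N n)%:R^-1)%:E by rewrite !PE.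
rewrite /P /= /mrestr classI lebesgue_measure_itv /= lte_fin.
rewrite ltr_pM2r ?invr_gt0// ltr_nat leqnn -EFinB -mulrBl.
by rewrite -natrB// subSnn mul1r.
Qed.

End UniformMeasure.

Section Invariance.
Context (X : pointedType) (agree : nat -> X -> set X).
Hypothesis tower : homogeneous_tower agree.
Local Notation T := (g_sigma_algebraType (cylinders agree)).
Context (R : realType).

(** The image of [mu] only has to give equal masses to the classes of each large
    level; it is then [mu], by uniqueness of the uniform measure. *)
Lemma uniform_preserved (mu : probability T R) (V : T -> T) r :
  (forall n x y, mu (agree n x) = mu (agree n y)) ->
  (forall n x, (r <= n)%N -> measurable (V @^-1` agree n x)) ->
  (forall n x y, (r <= n)%N ->
    mu (V @^-1` agree n x) = mu (V @^-1` agree n y)) ->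
  measurable_fun setT V /\ forall A, measurable A -> mu (V @^-1` A) = mu A.
Proof.
move=> muE mV muV.
have mfV : measurable_fun setT V.
  apply: (@measurability _ _ _ T _ V (cylinders agree)) => //.
  move=> _ [_ [n [x ->]] <-].
  have sat y z : agree (maxn r n) y z -> agree n x y -> agree n x z.
    move=> yz xy; apply: (agree_trans tower) xy _.
    exact: agree_le (leq_maxr _ _) yz.
  rewrite setTI (saturated_bigcup tower sat) preimage_bigcup.
  apply: fin_bigcup_measurable.
    exact: sub_finite_set (@subIsetl _ _ _) (agree_fin tower _).
  by move=> _ [[y _ <-] _]; apply: mV; exact: leq_maxl.
split=> // A mA; have [Q QE] := probability_image mu mfV.
rewrite -QE; apply: (@tower_measure_unique _ _ tower _ _ _ r) => // n x y rn.
by rewrite !QE; exact: muV.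
Qed.

Lemma uniform_symmetry (mu : probability T R) (V : T -> T) :
  (forall n x y, mu (agree n x) = mu (agree n y)) ->
  (forall y, exists x, V x = y) ->
  (forall n x y, agree n (V x) (V y) <-> agree n x y) ->
  measurable_fun setT V /\ forall A, measurable A -> mu (V @^-1` A) = mu A.
Proof.
move=> muE Vs Va.
have VE n x : exists y, V @^-1` agree n x = agree n y.
  have [y <-] := Vs x; exists y.
  by apply/seteqP; split=> z /Va.
apply: (@uniform_preserved _ _ 0) => // n x.
  by have [y ->] := VE n x => _; exact: measurable_class.
by move=> z _; have [y ->] := VE n x; have [w ->] := VE n z.
Qed.

End Invariance.

(** * The space is standard Borel *)

Section Ultrametric.
Context (X : pointedType) (agree : nat -> X -> set X).
Hypothesis tower : homogeneous_tower agree.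
Local Notation T := (g_sigma_algebraType (cylinders agree)).
Context (R : realType).

Definition disagreements (x y : X) : set R :=
  [set e | e = 0%R \/ exists2 n, ~ agree n x y & e = n.+1%:R^-1%R].

(** This is [n.+1%:R^-1] for the first level [n] at which [x] and [y] disagree;
    as a supremum, it can be compared to a number level by level. *)
Definition tower_dist x y : R := sup (disagreements x y).

Lemma tower_dist_le x y (e : R) : (0 <= e)%R ->
  (forall n, ~ agree n x y -> (n.+1%:R^-1 <= e)%R) -> (tower_dist x y <= e)%R.
Proof.
move=> e0 eP; apply: ge_sup; first by exists 0%R; left.
by move=> _ [->//|[n nxy ->]]; exact: eP.
Qed.

Lemma has_sup_disagreements x y : has_sup (disagreements x y).
Proof.
split; first by exists 0%R; left.
by exists 1%R => _ [->//|[n _ ->]]; rewrite invf_le1 ?ler1n ?ltr0n.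
Qed.

Lemma tower_dist_ge0 x y : (0 <= tower_dist x y)%R.
Proof. by apply: sup_upper_bound; [exact: has_sup_disagreements|left]. Qed.

Lemma tower_dist_ge n x y : ~ agree n x y -> (n.+1%:R^-1 <= tower_dist x y)%R.
Proof.
move=> nxy; apply: sup_upper_bound; first exact: has_sup_disagreements.
by right; exists n.
Qed.

Lemma tower_dist_lt n x y : (tower_dist x y < n.+1%:R^-1)%R <-> agree n x y.
Proof.
split=> [|xy].
  by apply: contraPP => /tower_dist_ge; rewrite leNgt => /negP.
apply: (@le_lt_trans _ _ n.+2%:R^-1%R); last first.
  by rewrite ltf_pV2 ?posrE ?ltr0n// ltr_nat.
apply: tower_dist_le => // m mxy; rewrite lef_pV2 ?posrE ?ltr0n// ler_nat.
by rewrite ltnS ltnNge; apply/negP => mn; apply: mxy; exact: agree_le mn xy.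
Qed.

Lemma tower_distxx x : tower_dist x x = 0%R.
Proof.
apply/le_anti; rewrite tower_dist_ge0 andbT; apply: tower_dist_le => // n [].
exact: agree_refl tower _ _.
Qed.

Lemma tower_dist_eq0 x y : tower_dist x y = 0%R -> x = y.
Proof.
by move=> d0; apply: (agree_sep tower) => n; apply/tower_dist_lt; rewrite d0.
Qed.

Lemma tower_dist_sym x y : tower_dist x y = tower_dist y x.
Proof.
wlog suff : x y / (tower_dist x y <= tower_dist y x)%R.
  by move=> H; apply/le_anti; rewrite !H.
apply: tower_dist_le => [|n nxy]; first exact: tower_dist_ge0.
by apply: tower_dist_ge => /(agree_sym tower).
Qed.

Lemma tower_dist_triangle y x z :
  (tower_dist x z <= tower_dist x y + tower_dist y z)%R.
Proof.
apply: tower_dist_le => [|n nxz]; first by rewrite addr_ge0 ?tower_dist_ge0.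
have [xy|nxy] := pselect (agree n x y).
  rewrite -[leLHS]add0r lerD ?tower_dist_ge0//; apply: tower_dist_ge => yz.
  exact: nxz (agree_trans tower xy yz).
by rewrite -[leLHS]addr0 lerD ?tower_dist_ge0//; exact: tower_dist_ge.
Qed.

(** Classes are the balls of the distance. There are countably many of them, so
    that they generate the Borel sets, and choosing a point in each gives a
    dense set. *)
Lemma tower_standard_borel : standard_borel R T.
Proof.
pose M : metricType R := HB.pack X (isMetric.Build R X
  tower_distxx tower_dist_eq0 tower_dist_sym tower_dist_triangle).
have ballE n (x : M) : ball x (n.+1%:R^-1) = agree n x.
  rewrite metric_structure.ballEmdist.
  by apply/seteqP; split=> y /tower_dist_lt.
have nbhs_class n (x : M) : nbhs x (agree n x).
  by rewrite -ballE; apply: nbhsx_ballx; rewrite invr_gt0.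
have class_nbhs (x : M) (A : set M) : nbhs x A -> exists n, agree n x `<=` A.
  move=> /nbhs_ballP[e /= e0 eA].
  have [n ne] : exists n, (n.+1%:R^-1 < e)%R.
    exists (Num.truncn e^-1); rewrite invf_plt ?posrE//.
    exact: truncnS_gt.
  exists n; apply: subset_trans eA; rewrite -ballE.
  exact: (@le_ball _ M x _ _ (ltW ne)).
exists M; split.
- move=> u /cauchy_ballP cu.
  have near n : exists N, forall i j, (N <= i)%N -> (N <= j)%N ->
      agree n (u i) (u j).
    have := cu n.+1%:R^-1%R; rewrite invr_gt0 ltr0Sn => /(_ isT).
    case=> -[A B] /= [[N _ NA] [N' _ NB]] AB.
    exists (maxn N N') => i j.
    rewrite !geq_max => /andP[Ni Ni'] /andP[Nj Nj'].
    rewrite -ballE; apply: (AB (u i, u j)); split; [exact: NA|exact: NB].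
  have [N NP] := choice near.
  (* [N] need not be nondecreasing, and [tower_limit] compares consecutive
     terms. *)
  pose K n := (\max_(i < n.+1) N i)%N.
  have NK n : (N n <= K n)%N by rewrite /K big_ord_recr /= leq_maxr.
  have KK n : (K n <= K n.+1)%N by rewrite /K [leqRHS]big_ord_recr leq_maxl.
  have [|x xP] := tower_limit tower (u := fun n => u (K n)).
    by move=> n; apply: NP => //; exact: leq_trans (KK n).
  exists x => A /class_nbhs[n nA]; exists (K n) => // i /= Ki; apply: nA.
  apply: (agree_trans tower (agree_sym tower (xP n))).
  by apply: NP => //; exact: leq_trans Ki.
- exists [set x | exists n (C : set X), range (agree n) C /\ x = get C].
    rewrite (_ : [set x | _] = \bigcup_n (get @` range (agree n))).
      apply: bigcup_countable => // n _; apply: finite_set_countable.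
      exact/finite_image/(agree_fin tower).
    apply/seteqP; split=> x.
      by move=> [n [C [rC ->]]]; exists n => //; exists C.
    by move=> [n _ [C rC <-]]; exists n, C.
  move=> A [x Ax] oA.
  have [n nA] := class_nbhs x A (open_nbhs_nbhs (conj oA Ax)).
  exists (get (agree n x)); split; last first.
    by exists n, (agree n x); split=> //; exists x.
  by apply: nA; apply: getPex; exists x; exact: agree_refl tower _ _.
- exists id; first by exists id.
  rewrite (_ : preimage_set_system _ _ _ = <<s @open M >>); last first.
    apply/seteqP; split=> [_ [A mA <-]|A mA].
      by rewrite setTI preimage_id.
    by exists A; rewrite // setTI preimage_id.
  rewrite eqEsubset; split; apply: smallest_sub.
  + exact: smallest_sigma_algebra.
  + move=> _ [n [x ->]]; apply: sub_sigma_algebra.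
    rewrite openE => y /(agree_classE tower) ->; exact: nbhs_class.
  + exact: sigma_algebra_measurable.
  + move=> A oA.
    rewrite (_ : A = \bigcup_n
        \bigcup_(C in range (agree n) `&` [set C | C `<=` A]) C).
      apply: bigcup_measurable => n _; apply: fin_bigcup_measurable.
        exact: sub_finite_set (@subIsetl _ _ _) (agree_fin tower n).
      by move=> _ [[x _ <-] _]; exact: measurable_class.
    apply/seteqP; split=> [x Ax|x [n _ [C [_ CA] Cx]]]; last exact: CA.
    have [n nA] := class_nbhs x A (open_nbhs_nbhs (conj oA Ax)).
    exists n => //; exists (agree n x); last exact: agree_refl tower _ _.
    by split=> //; exists x.
Qed.

End Ultrametric.

Local Open Scope group_scope.

(** * Balls of Cayley graphs *)

Section Balls.
Context (G : groupType) (S : set G).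

Fixpoint word_ball n : set G :=
  if n is m.+1 then
    word_ball m `|` [set g * s | g in word_ball m & s in S]
  else [set 1].

Lemma word_ball1 n : word_ball n 1.
Proof. by elim: n => [|n IH] //; left. Qed.

Lemma word_ball_le m n : (m <= n)%N -> word_ball m `<=` word_ball n.
Proof.
elim: n => [|n IH]; first by rewrite leqn0 => /eqP ->.
rewrite leq_eqVlt => /orP[/eqP -> //|]; rewrite ltnS => mn g /(IH mn).
by left.
Qed.

Lemma word_ballM m n x y :
  word_ball m x -> word_ball n y -> word_ball (m + n) (x * y).
Proof.
move=> mx; elim: n y => [y ->|n IH y]; first by rewrite mulg1 addn0.
rewrite addnS => -[/IH|]; first by left.
move=> [z /IH mz [s Ss <-]]; right.
by exists (x * z) => //; exists s; rewrite ?mulgA.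
Qed.

Hypothesis hS : finite_generating_system S.

Lemma word_ballV n x : word_ball n x -> word_ball n x^-1.
Proof.
elim: n x => [_ ->|n IH x]; first by rewrite invg1.
move=> [/IH|[y /IH ny [s Ss <-]]]; first by left.
rewrite invgM -add1n; apply: word_ballM => //.
right; exists 1 => //; exists s^-1; rewrite ?mul1g//.
exact: (fgs_symmetric hS).
Qed.

Lemma word_ball_cover x : exists n, word_ball n x.
Proof.
suff : generated S `<=` \bigcup_n word_ball n.
  by rewrite (fgs_generates hS) => /(_ x Logic.I)[n _]; exists n.
apply: smallest_sub.
  split; first by exists 0%N.
    by move=> y z [m _ my] [n _ nz]; exists (m + n)%N => //; exact: word_ballM.
  by move=> y [n _ ny]; exists n => //; exact: word_ballV.
move=> s Ss; exists 1%N => //; right.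
by exists 1 => //; exists s; rewrite ?mul1g.
Qed.

Lemma word_ball_finite n : finite_set (word_ball n).
Proof.
elim: n => [|n IH]; first exact: finite_set1.
rewrite /= finite_setU; split=> //.
exact: finite_image2 IH (fgs_finite hS).
Qed.

Lemma enum_group : exists u : nat -> G, forall g, exists n, u n = g.
Proof.
have : countable [set: G].
  rewrite (_ : [set: G] = \bigcup_n word_ball n).
    apply: bigcup_countable => // n _.
    exact/finite_set_countable/word_ball_finite.
  apply/esym; rewrite -subTset => g _.
  by have [n ng] := word_ball_cover g; exists n.
move=> /countable_injP[f fI].
exists (fun n => xget 1 (f @^-1` [set n])) => g; exists (f g).
have : (f @^-1` [set f g]) (xget 1 (f @^-1` [set f g])).
  by apply: xgetPex; exists g.
by move=> /fI; apply; rewrite inE.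
Qed.

End Balls.

(** * Rooted coloured isomorphisms *)

Lemma finite_range_map (I : eqType) (X V : Type) (F : X -> I -> V) (s : seq I) :
  (forall i, i \in s -> finite_set (range (F ^~ i))) ->
  finite_set (range (fun x => [seq F x i | i <- s])).
Proof.
elim: s => [|i s IH] Fs.
  by apply: sub_finite_set (finite_set1 [::]) => _ [x _ <-].
have {IH}Fs' : finite_set (range (fun x => [seq F x j | j <- s])).
  by apply: IH => j js; apply: Fs; rewrite inE js orbT.
have Fi : finite_set (range (F ^~ i)) by apply: Fs; rewrite mem_head.
apply: sub_finite_set (finite_image2 cons Fi Fs') => _ [x _ <-] /=.
by exists (F x i); [exists x|exists [seq F x j | j <- s] => //; exists x].
Qed.

Section Rooted.
Context (G L : groupType) (SG : set G) (SL : set L).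
Hypothesis hG : finite_generating_system SG.
Hypothesis hL : finite_generating_system SL.

(** The colours serve only to make the actions free.  Each vertex carries
    infinitely many bits, as with finitely many of them a finite group would
    fix points with positive probability. *)
Record rooted_iso := RootedIso {
  iso_fun : G -> L;
  iso_color : G -> nat -> bool;
  iso_inj : injective iso_fun;
  iso_surj : forall l, exists g, iso_fun g = l;
  iso_edge : forall g h,
    cayley_edge SL (iso_fun g) (iso_fun h) <-> cayley_edge SG g h;
  iso_fun1 : iso_fun 1 = 1 }.

HB.instance Definition _ := gen_eqMixin rooted_iso.
HB.instance Definition _ := gen_choiceMixin rooted_iso.
Lemma rooted_iso_eq (x y : rooted_iso) :
  (forall g, iso_fun x g = iso_fun y g) ->
  (forall g j, iso_color x g j = iso_color y g j) -> x = y.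
Proof.
case: x y => [f c fI fS fE f1] [f' c' fI' fS' fE' f1'] /= ff' cc'.
have e : f = f' by apply/funext.
have e' : c = c' by apply/funext => g; apply/funext => j.
by subst f' c'; congr RootedIso; exact: Prop_irrelevance.
Qed.

Definition iso_inv (x : rooted_iso) l : G := sval (cid (iso_surj x l)).

Lemma iso_invK x l : iso_fun x (iso_inv x l) = l.
Proof. by rewrite /iso_inv; case: cid. Qed.

Lemma iso_funK x g : iso_inv x (iso_fun x g) = g.
Proof. by apply: (@iso_inj x); rewrite iso_invK. Qed.

Lemma cayley_edgeM (K : groupType) (S : set K) k g h :
  cayley_edge S (k * g) (k * h) <-> cayley_edge S g h.
Proof.
split=> -[s Ss e]; exists s => //; last by rewrite e mulgA.
by apply: (mulgI k); rewrite e mulgA.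
Qed.

Lemma iso_gen x g : SL (iso_fun x g) <-> SG g.
Proof.
have gen (K : groupType) (S : set K) s : cayley_edge S 1 s <-> S s.
  by split=> [[t St ->]|Ss]; [rewrite mul1g|exists s; rewrite ?mul1g].
by rewrite -gen -(gen _ SG) -(iso_edge x 1) iso_fun1.
Qed.

(** Finiteness of the levels and surjectivity of limits of isomorphisms both
    rest on this: an isomorphism fixing the roots maps balls onto balls. *)
Lemma iso_ball x n g : word_ball SL n (iso_fun x g) <-> word_ball SG n g.
Proof.
split; elim: n g => [g|n IH g].
- by rewrite /= -(iso_fun1 x) => /iso_inj.
- move=> [/IH|]; first by left.
  move=> [l nl [t St e]]; right; exists (iso_inv x l).
    by apply: IH; rewrite iso_invK.
  have [s Ss ->] : cayley_edge SG (iso_inv x l) g.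
    by apply/(iso_edge x); rewrite iso_invK; exists t.
  by exists s.
- by move=> ->; rewrite iso_fun1.
- move=> [/IH|]; first by left.
  move=> [h nh [s Ss e]]; right; exists (iso_fun x h); first exact: IH.
  have [t St ->] : cayley_edge SL (iso_fun x h) (iso_fun x g).
    by apply/(iso_edge x); exists s.
  by exists t.
Qed.

Definition agree_on (F : set G) n (x y : rooted_iso) : Prop :=
  forall g, F g -> iso_fun x g = iso_fun y g /\
    forall j, (j < n)%N -> iso_color x g j = iso_color y g j.

Definition iso_agree n : rooted_iso -> set rooted_iso :=
  agree_on (word_ball SG n) n.

Lemma agree_on_sub F F' n n' x y : F `<=` F' -> (n <= n')%N ->
  agree_on F' n' x y -> agree_on F n x y.
Proof.
move=> FF' nn' xy g /FF' /xy[-> cE]; split=> // j jn.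
by apply: cE; exact: leq_trans nn'.
Qed.

Lemma agree_on_trans F n y x z :
  agree_on F n x y -> agree_on F n y z -> agree_on F n x z.
Proof.
move=> xy yz g Fg; have [-> cxy] := xy g Fg; have [-> cyz] := yz g Fg.
by split=> // j jn; rewrite cxy ?cyz.
Qed.

Lemma agree_on_sym F n x y : agree_on F n x y -> agree_on F n y x.
Proof.
move=> xy g Fg; have [-> cxy] := xy g Fg.
by split=> // j jn; rewrite cxy.
Qed.

(** The symmetry that brings [x] to [y]: composition on the left with an
    automorphism of the target graph, and addition of a fixed colouring. It acts
    on values only, and therefore respects agreement on every set of
    vertices. *)
Program Definition iso_transport (x y z : rooted_iso) : rooted_iso :=
  @RootedIso (fun g => iso_fun y (iso_inv x (iso_fun z g)))
    (fun g j => iso_color z g j (+) (iso_color x g j (+) iso_color y g j))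
    _ _ _ _.
Next Obligation.
move=> x y z g h /iso_inj /(congr1 (iso_fun x)).
by rewrite !iso_invK => /iso_inj.
Qed.
Next Obligation.
move=> x y z l; exists (iso_inv z (iso_fun x (iso_inv y l))).
by rewrite iso_invK iso_funK iso_invK.
Qed.
Next Obligation.
by move=> x y z g h; rewrite iso_edge -(iso_edge x) !iso_invK iso_edge.
Qed.
Next Obligation.
move=> x y z /=; rewrite iso_fun1 -[X in iso_inv x X](iso_fun1 x).
by rewrite iso_funK iso_fun1.
Qed.

Lemma iso_transport_id x y : iso_transport x y x = y.
Proof.
apply: rooted_iso_eq => [g|g j] /=; first by rewrite iso_funK.
by rewrite addKb.
Qed.

Lemma iso_transportK x y z : iso_transport x y (iso_transport y x z) = z.
Proof.
apply: rooted_iso_eq => [g|g j] /=; first by rewrite iso_funK iso_invK.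
by rewrite [X in _ (+) X]addbC addbK.
Qed.

Lemma agree_on_transport F n x y z w :
  agree_on F n (iso_transport x y z) (iso_transport x y w) <->
  agree_on F n z w.
Proof.
split=> zw g Fg; have [fE cE] := zw g Fg; split=> [|j jn].
- by move: fE => /= /iso_inj /(congr1 (iso_fun x)); rewrite !iso_invK.
- by have := cE j jn => /= /addIb.
- by rewrite /= fE.
- by rewrite /= cE.
Qed.

(** A class is determined by the list of the values on a ball, which are taken
    in a finite set. *)
Lemma finite_iso_agree n : finite_set (range (iso_agree n)).
Proof.
have /finite_seqP[s sE] := word_ball_finite hG n.
pose F x g := (iso_fun x g, [seq iso_color x g j | j <- iota 0 n]).
pose code x := [seq F x g | g <- s].
have in_s g : g \in s <-> word_ball SG n g by rewrite sE.
have codeE x y : iso_agree n x y <-> code y = code x.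
  split=> [xy|/eq_in_map xy g /in_s /xy[-> /eq_in_map cE]].
    apply/eq_in_map => g /in_s /xy[fE cE]; rewrite /F fE; congr pair.
    by apply/eq_in_map => j; rewrite mem_iota add0n => /cE.
  by split=> // j jn; rewrite cE// mem_iota.
have code_fin : finite_set (range code).
  apply: finite_range_map => g /in_s gn.
  have col_fin :
      finite_set (range (fun x => [seq iso_color x g j | j <- iota 0 n])).
    by apply: finite_range_map => j _; exact: finite_finset.
  apply: sub_finite_set (finite_setX (word_ball_finite hL n) col_fin).
  move=> _ [x _ <-].
  by split=> /=; [exact/iso_ball|exists x].
apply: sub_finite_set (finite_image (fun w => [set y | code y = w]) code_fin).
move=> _ [x _ <-]; exists (code x); first by exists x.
by apply/seteqP; split=> y /codeE.
Qed.

Lemma iso_tower : homogeneous_tower iso_agree.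
Proof.
split.
- by move=> n x g _.
- by move=> n x y; exact: agree_on_sym.
- by move=> n y x z; exact: agree_on_trans.
- by move=> x y g ->; rewrite !iso_fun1; split.
- by move=> n x y; apply: agree_on_sub => // g; left.
- move=> x y xy; apply: rooted_iso_eq => [g|g j].
    by have [n ng] := word_ball_cover hG g; have [] := xy n g ng.
  have [n ng] := word_ball_cover hG g.
  have [_ ->//] := xy (maxn n j.+1) g (word_ball_le (leq_maxl _ _) ng).
  exact: leq_maxr.
- move=> u uP.
  (* The limit takes at [g] the value of any term whose index is large enough
     for its ball to contain [g]. *)
  pose rad g := sval (cid (word_ball_cover hG g)).
  have radP g : word_ball SG (rad g) g by rewrite /rad; case: cid.
  have uE m n g : word_ball SG m g -> word_ball SG n g ->
      iso_fun (u m) g = iso_fun (u n) g /\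
      forall j, (j < m)%N -> (j < n)%N ->
        iso_color (u m) g j = iso_color (u n) g j.
    wlog mn : m n / (m <= n)%N.
      move=> H mg ng; have [/H|/ltnW/H] := leqP m n; first exact.
      by move=> /(_ ng mg)[-> cE]; split=> // j jm jn; rewrite cE.
    move=> mg ng; have [-> cE] := uP m n mn g mg.
    by split=> // j jm jn; rewrite cE.
  pose f g := iso_fun (u (rad g)) g.
  have fE n g : word_ball SG n g -> f g = iso_fun (u n) g.
    by move=> ng; have [] := uE (rad g) n g (radP g) ng.
  have two g h : exists n, word_ball SG n g /\ word_ball SG n h.
    exists (maxn (rad g) (rad h)).
    by split; [exact: word_ball_le (leq_maxl _ _) _ (radP g)
              |exact: word_ball_le (leq_maxr _ _) _ (radP h)].
  pose c g j := iso_color (u (maxn (rad g) j.+1)) g j.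
  have fI : injective f.
    move=> g h; have [n [ng nh]] := two g h.
    by rewrite (fE _ _ ng) (fE _ _ nh) => /iso_inj.
  have fS l : exists g, f g = l.
    have [n nl] := word_ball_cover hL l.
    exists (iso_inv (u n) l); rewrite (fE n) ?iso_invK//.
    by apply/(iso_ball (u n)); rewrite iso_invK.
  have fEd g h : cayley_edge SL (f g) (f h) <-> cayley_edge SG g h.
    have [n [ng nh]] := two g h.
    by rewrite (fE _ _ ng) (fE _ _ nh); exact: iso_edge.
  have f1 : f 1 = 1 by rewrite /f iso_fun1.
  exists (RootedIso c fI fS fEd f1) => n g ng /=; split.
    by rewrite (fE n).
  move=> j jn; rewrite /c.
  have rg : word_ball SG (maxn (rad g) j.+1) g.
    exact: word_ball_le (leq_maxl _ _) _ (radP g).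
  by have [_ ->] := uE _ _ g ng rg; rewrite ?leq_max ?ltnSn ?orbT.
- exact: finite_iso_agree.
- move=> x y; exists (iso_transport x y); split.
  + exact: iso_transport_id.
  + by move=> z; exists (iso_transport y x z); exact: iso_transportK.
  + by move=> n z w; exact: agree_on_transport.
Qed.

End Rooted.

(** * The two actions *)

Lemma disjoint_copies_null d (T : measurableType d) (R : realType)
    (P : probability T R) (F : nat -> set T) (D : set T) :
  (forall i, measurable (F i)) -> trivIset setT F ->
  measurable D -> (forall i, P (F i) = P D) -> P D = 0%E.
Proof.
move=> mF tF mD FD.
have finD : P D \is a fin_num by exact: fin_num_measure.
have D0 : (0 <= fine (P D))%R by exact: fine_ge0.
have bound k : (fine (P D) *+ k <= 1)%R.
  have mU : measurable (\big[setU/set0]_(i < k) F i).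
    by apply: bigsetU_measurable => i _.
  rewrite -lee_fin; apply: le_trans (probability_le1 P mU).
  rewrite measure_bigsetU// (eq_bigr (fun=> (fine (P D))%:E)) => [|i _].
    by rewrite sumEFin sumr_const card_ord.
  by transitivity (P D); [exact: FD|rewrite fineK].
rewrite -(fineK finD); congr EFin; apply/le_anti; rewrite D0 andbT leNgt.
apply/negP => Dgt0; have := bound (Num.truncn (fine (P D))^-1).+1.
rewrite leNgt => /negP; apply.
by rewrite -mulr_natr mulrC -ltr_pdivrMr// div1r truncnS_gt.
Qed.

Section Actions.
Context (G L : groupType) (SG : set G) (SL : set L).
Hypothesis hG : finite_generating_system SG.
Hypothesis hL : finite_generating_system SL.
Local Notation X := (rooted_iso SG SL).

(** The root is moved to [g], and the isomorphism composed with a translation so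
    that it fixes the roots again. *)
Program Definition reroot (g : G) (x : X) : X :=
  @RootedIso _ _ SG SL (fun h => (iso_fun x g)^-1 * iso_fun x (g * h))
    (fun h => iso_color x (g * h)) _ _ _ _.
Next Obligation. by move=> g x h k /mulgI /iso_inj /mulgI. Qed.
Next Obligation.
move=> g x l; exists (g^-1 * iso_inv x (iso_fun x g * l)).
by rewrite mulVKg iso_invK mulKg.
Qed.
Next Obligation.
by move=> g x h k /=; rewrite cayley_edgeM iso_edge cayley_edgeM.
Qed.
Next Obligation. by move=> g x /=; rewrite mulg1 mulVg. Qed.

Lemma reroot1 x : reroot 1 x = x.
Proof.
apply: rooted_iso_eq => [g|g j] /=; last by rewrite mul1g.
by rewrite iso_fun1 invg1 !mul1g.
Qed.

Lemma rerootM g h x : reroot (g * h) x = reroot h (reroot g x).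
Proof.
apply: rooted_iso_eq => [k|k j] /=; last by rewrite mulgA.
by rewrite invgM invgK !mulgA mulgK.
Qed.

Lemma rerootK g x : reroot g^-1 (reroot g x) = x.
Proof. by rewrite -rerootM mulgV reroot1. Qed.

Lemma rerootVK g x : reroot g (reroot g^-1 x) = x.
Proof. by rewrite -rerootM mulVg reroot1. Qed.

Definition source_action (g : G) (x : X) : X := reroot g^-1 x.

Definition target_action (l : L) (x : X) : X := reroot (iso_inv x l^-1) x.

Lemma source_actionM g h x :
  source_action (g * h) x = source_action g (source_action h x).
Proof. by rewrite /source_action invgM rerootM. Qed.

Lemma target_action1 x : target_action 1 x = x.
Proof. by rewrite /target_action invg1 -(iso_fun1 x) iso_funK reroot1. Qed.

Lemma target_actionM l m x :
  target_action (l * m) x = target_action l (target_action m x).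
Proof.
rewrite /target_action -rerootM; congr reroot; apply: (@iso_inj _ _ _ _ x).
set g := iso_inv x m^-1; set y := reroot g x.
have : iso_fun y (iso_inv y l^-1) = l^-1 by rewrite iso_invK.
rewrite /= {1}/g iso_invK invgK => e.
by rewrite iso_invK invgM; apply: (mulgI m); rewrite mulVKg.
Qed.

(** Moving the root of [x] along the edge from [1] to [s] is moving it along the
    edge from [1] to [iso_fun x s] in the other graph. *)
Lemma orbit_edge_actions x y :
  orbit_edge SL target_action x y <-> orbit_edge SG source_action x y.
Proof.
split=> [[t St <-]|[s Ss <-]].
  exists (iso_inv x t^-1)^-1; last by rewrite /source_action invgK.
  apply: (fgs_symmetric hG); apply/(iso_gen x); rewrite iso_invK.
  exact: (fgs_symmetric hL).
exists (iso_fun x s^-1)^-1; last by rewrite /target_action invgK iso_funK.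
by apply: (fgs_symmetric hL); apply/iso_gen; exact: (fgs_symmetric hG).
Qed.

(** Rerooting divides the values of [iso_fun] by the value at [g], so that it could
    make different restrictions equal; agreement at [g^-1] of the rerooted points
    means that the two divisors are equal. *)
Lemma agree_on_reroot F n g x y : F 1 -> F g^-1 ->
  agree_on F n (reroot g x) (reroot g y) <->
  agree_on [set g * h | h in F] n x y.
Proof.
move=> F1 Fg; split=> [xy _ [h Fh <-]|xy h Fh].
  have [/= ] := xy _ Fg; rewrite !mulgV !iso_fun1 !mulg1 => /invg_inj eg _.
  by have [/= ] := xy _ Fh; rewrite eg => /mulgI eh cE; split.
have [eg _] := xy g (ex_intro2 _ _ 1 F1 (mulg1 g)).
have [eh cE] := xy _ (ex_intro2 _ _ h Fh erefl).
by split=> //=; rewrite eg eh.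
Qed.

Section Measure.
Context (x0 : X) (R : realType).

Let pX : pointedType := HB.pack X (isPointed.Build X x0).

Local Notation T :=
  (g_sigma_algebraType (@cylinders pX (@iso_agree _ _ SG SL))).
Let tower : homogeneous_tower (@iso_agree _ _ SG SL) := iso_tower hG hL.

Context (mu : probability T R).
Hypothesis muE : forall n (x y : pX), mu (iso_agree n x) = mu (iso_agree n y).

Lemma transport_preserved x y :
  measurable_fun setT (iso_transport x y : T -> T) /\
  forall A : set T, measurable A -> mu (iso_transport x y @^-1` A) = mu A.
Proof.
apply: (@uniform_symmetry pX _ tower) => [//|z|n z w].
  by exists (iso_transport y x z); exact: iso_transportK.
exact: agree_on_transport.
Qed.

Lemma agree_on_measurable F n x : (exists m, F `<=` word_ball SG m) ->
  measurable (agree_on F n x : set T).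
Proof.
move=> [m Fm].
apply: (@measurable_saturated pX _ tower (maxn m n)) => y z yz xy.
apply: agree_on_trans xy _; apply: agree_on_sub yz; last exact: leq_maxr.
exact: subset_trans (word_ball_le (leq_maxl _ _)).
Qed.

(** The levels do not enter: the symmetry bringing [x] to [y] preserves the
    measure, and maps one class to the other. *)
Lemma agree_on_measure F n x y : (exists m, F `<=` word_ball SG m) ->
  mu (agree_on F n x) = mu (agree_on F n y).
Proof.
move=> Fm; have [_ inv] := transport_preserved x y.
rewrite -(inv _ (agree_on_measurable n y Fm)).
have yE z : agree_on F n y (iso_transport x y z) <-> agree_on F n x z.
  by rewrite -[X in agree_on _ _ X _](iso_transport_id x y) agree_on_transport.
by congr (mu _); apply/seteqP; split=> z /yE.
Qed.

(** The translate by [g] of the ball of radius [n] is no longer centred at the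
    root. All classes of agreement on it have the same measure nevertheless,
    which is what the criterion asks; that this measure is the one of the
    classes of level [n] then follows, without counting. *)
Lemma reroot_preserved g : measurable_fun setT (reroot g : T -> T) /\
  forall A : set T, measurable A -> mu (reroot g @^-1` A) = mu A.
Proof.
have [r rg] := word_ball_cover hG g.
pose F n := [set g * h | h in word_ball SG n].
have Fm n : exists m, F n `<=` word_ball SG m.
  by exists (r + n)%N => _ [h nh <-]; exact: word_ballM.
have VE n (p : pX) : (r <= n)%N ->
    reroot g @^-1` iso_agree n p = agree_on (F n) n (reroot g^-1 p).
  move=> rn; rewrite -{1}(rerootVK g p).
  have n1 := word_ball1 SG n.
  have ng : word_ball SG n g^-1 by exact/(word_ballV hG)/(word_ball_le rn).
  by apply/seteqP; split=> z /= /(agree_on_reroot _ _ _ n1 ng).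
apply: (@uniform_preserved pX _ tower _ _ _ r) => // n p.
  by move=> rn; rewrite VE//; exact: agree_on_measurable.
by move=> q rn; rewrite !VE//; exact: agree_on_measure.
Qed.

(** The vertex to which the root is moved depends on the point, but it is
    constant on the image class: there the inverse of [target_action l] moves
    the root to the vertex where the isomorphism takes the value [l]. *)
Lemma target_preserved l : measurable_fun setT (target_action l : T -> T) /\
  forall A : set T, measurable A -> mu (target_action l @^-1` A) = mu A.
Proof.
have [r rl] := word_ball_cover hL l.
have VE n (p : pX) : (r <= n)%N -> exists g,
    target_action l @^-1` iso_agree n p = reroot g @^-1` iso_agree n p.
  move=> rn; exists (iso_inv p l)^-1.
  have ng : word_ball SG n (iso_inv p l).
    by apply/(iso_ball p); rewrite iso_invK; exact: word_ball_le rl.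
  have inv_near y : iso_agree n p y -> iso_inv y l = iso_inv p l.
    move=> py; apply: (@iso_inj _ _ _ _ y).
    by have [<- _] := py _ ng; rewrite !iso_invK.
  have targetV y : target_action l^-1 y = reroot (iso_inv y l) y.
    by rewrite /target_action invgK.
  apply/seteqP; split=> x /= px.
    rewrite -(inv_near _ px); set y := target_action l x in px *.
    have -> : x = reroot (iso_inv y l) y.
      by rewrite -targetV /y -target_actionM mulVg target_action1.
    by rewrite rerootK.
  set y := reroot _ x in px.
  have -> : x = target_action l^-1 y.
    by rewrite targetV (inv_near _ px) rerootVK.
  by rewrite -target_actionM mulgV target_action1.
have mE n (p : pX) : (r <= n)%N ->
    measurable (target_action l @^-1` iso_agree n p : set T) /\
    mu (target_action l @^-1` iso_agree n p) = mu (iso_agree n p).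
  move=> /VE -/(_ p)[g ->]; have [mg pg] := reroot_preserved g.
  have mp : measurable (iso_agree n p : set T) by exact: measurable_class.
  by split; [rewrite -[X in measurable X]setTI; exact: mg|exact: pg].
apply: (@uniform_preserved pX _ tower _ _ _ r) => // n p.
  by move=> /mE -/(_ p)[].
by move=> q rn; have [_ ->] := mE n p rn; have [_ ->] := mE n q rn.
Qed.

(** A fixed point of [reroot g] has the same colours at [g] and at [1]. Changing
    the [j]-th bit at [1] preserves the measure and breaks the equality exactly
    at [j], so that the set of points with these equal colours has infinitely
    many disjoint copies. *)
Lemma reroot_free : {ae mu, forall x, forall g, reroot g x = x -> g = 1}.
Proof.
pose D g : set T := \bigcap_j [set x | iso_color x g j = iso_color x 1 j].
have mD g : measurable (D g).
  apply: bigcap_measurable => [|j _]; first by exists 0%N.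
  have [r rg] := word_ball_cover hG g.
  apply: (@measurable_saturated pX _ tower (maxn r j.+1)) => x y xy /=.
  have [_ cg] := xy g (word_ball_le (leq_maxl _ _) rg).
  have [_ c1] := xy 1 (word_ball1 _ _).
  by rewrite cg ?c1// leq_maxr.
have D0 g : g <> 1 -> mu (D g) = 0%E.
  move=> g1.
  pose flip j : X := RootedIso
    (fun h i => iso_color x0 h i (+) ((h == 1) && (i == j)))
    (@iso_inj _ _ _ _ x0) (@iso_surj _ _ _ _ x0) (@iso_edge _ _ _ _ x0)
    (iso_fun1 x0).
  have colE j x h i : iso_color (iso_transport x0 (flip j) x) h i =
      iso_color x h i (+) ((h == 1) && (i == j)) by rewrite /= addKb.
  pose F j : set T := iso_transport x0 (flip j) @^-1` D g.
  have FE j : measurable (F j) /\ mu (F j) = mu (D g).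
    have [mt pt] := transport_preserved x0 (flip j).
    by split; [rewrite -[X in measurable X]setTI; exact: mt|exact: pt].
  apply: (@disjoint_copies_null _ _ _ mu F) => //;
    try by move=> i; have [] := FE i.
  have g1' : (g == 1) = false by apply/eqP.
  move=> i j _ _ [x [Fi Fj]]; apply/eqP; apply: contraT => ij.
  have Fii : iso_color (iso_transport x0 (flip i) x) g i =
             iso_color (iso_transport x0 (flip i) x) 1 i := Fi i Logic.I.
  have Fji : iso_color (iso_transport x0 (flip j) x) g i =
             iso_color (iso_transport x0 (flip j) x) 1 i := Fj i Logic.I.
  move: Fii Fji; rewrite !colE g1' !eqxx (negbTE ij) !addbF => ->.
  by case: (iso_color _ _ _).
have [u uP] := enum_group hG.
pose N : nat -> set T := fun n => if u n == 1 then set0 else D (u n).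
have N0 n : mu.-negligible (N n).
  rewrite /N; case: eqP => [_|un]; first exact: negligible_set0.
  by apply/negligibleP => //; exact: D0.
apply: (negligibleS _ (negligible_bigcup N0)) => x /=.
move=> /existsNP[g /not_implyP[gx g1]].
have [n un] := uP g; exists n => //; rewrite /N un; case: eqP => // _ j _ /=.
by rewrite -{2}gx /= mulg1.
Qed.

End Measure.
End Actions.

(** * Distances in graphs *)

Section GraphDistance.
Context (R : realType).

(** The hypothesis excludes the path of length [0]. *)
Lemma graph_dist_edge (V : Type) (E : V -> V -> Prop) x y : x <> y ->
  E x y <-> (graph_dist (R := R) E x y <= 1)%E.
Proof.
move=> xy; split=> [Exy|].
  apply: ereal_inf_lbound; exists [:: y] => //=.
  by split=> //; rewrite asboolT.
move=> d1; have : (graph_dist (R := R) E x y < 2%:E)%E.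
  by apply: le_lt_trans d1 _; rewrite lte_fin ltr1n.
move=> /ereal_inf_lt[_ [[|z [|? ?]] [/= pz lz] <-]] //.
- by move: pz; rewrite andbT => /asboolP; rewrite lz.
- by rewrite lte_fin (ltr_nat R _ 2).
Qed.

Lemma graph_dist_path (V : Type) (E : V -> V -> Prop) x y :
  (graph_dist (R := R) E x y < +oo)%E <->
  exists2 p, path (fun u v => `[< E u v >]) x p & last x p = y.
Proof.
split=> [/ereal_inf_lt[_ [p [pp lp] _] _]|[p pp lp]]; first by exists p.
apply: (@le_lt_trans _ _ ((size p)%:R)%:E); last exact: ltry.
by apply: ereal_inf_lbound; exists p.
Qed.

(** For the orbit map of a free point, [W] is the whole space and [phi] reaches
    only a component of the orbit graph; hence a condition on all edges that
    start in the image. *)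
Section LocalIsomorphism.
Context (V W : Type) (EV : V -> V -> Prop) (EW : W -> W -> Prop) (phi : V -> W).
Hypothesis phi_edge :
  forall v w, EW (phi v) w <-> exists2 v', EV v v' & w = phi v'.

Lemma path_lift v p : path (fun u w => `[< EW u w >]) (phi v) p ->
  exists2 q, path (fun u w => `[< EV u w >]) v q & p = map phi q.
Proof.
elim: p v => [|w p IH] v /=; first by exists [::].
move=> /andP[/asboolP/phi_edge[v' vv' ->] /IH[q pq ->]].
by exists (v' :: q) => //=; rewrite asboolT.
Qed.

Lemma graph_dist_embedding : injective phi ->
  forall v v', graph_dist (R := R) EW (phi v) (phi v') = graph_dist EV v v'.
Proof.
move=> phi_inj v v'; congr ereal_inf; apply/seteqP; split=> _ [p [pp lp] <-].
  have [q pq pE] := path_lift pp; exists q; last by rewrite pE size_map.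
  by split=> //; apply: phi_inj; rewrite -lp pE last_map.
exists (map phi p); last by rewrite size_map.
split; last by rewrite last_map lp.
elim: p v pp {lp} => //= w p IH v /andP[/asboolP vw /IH ->]; rewrite andbT.
by apply/asboolP/phi_edge; exists w.
Qed.

End LocalIsomorphism.
End GraphDistance.

Lemma cayley_connected (R : realType) (G : groupType) (S : set G) g h :
  finite_generating_system S -> (cayley_dist (R := R) S g h < +oo)%E.
Proof.
move=> hS; apply/graph_dist_path.
suff : forall n k, word_ball S n k ->
    exists2 p, path (fun u v => `[< cayley_edge S u v >]) g p &
               last g p = g * k.
  have [n ng] := word_ball_cover hS (g^-1 * h).
  by move=> /(_ _ _ ng); rewrite mulVKg.
elim=> [_ ->|n IH k]; first by exists [::]; rewrite //= mulg1.
move=> [/IH //|[l /IH[p pp lp] [s Ss <-]]].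
exists (rcons p (g * (l * s))); last by rewrite last_rcons.
by rewrite rcons_path pp lp; apply/asboolP; exists s; rewrite ?mulgA.
Qed.

(** Edges are the pairs of distinct vertices at distance at most [1]; there are
    no loops, as [1] is not a generator. *)
Lemma isometry_edge (R : realType) (G L : groupType) (SG : set G) (SL : set L)
    (hG : finite_generating_system SG) (hL : finite_generating_system SL)
    (f : G -> L) : injective f ->
  (forall g h, cayley_dist SL (f g) (f h) = cayley_dist SG g h :> \bar R) ->
  forall g h, cayley_edge SL (f g) (f h) <-> cayley_edge SG g h.
Proof.
move=> fI fd g h.
have loopless (K : groupType) (S : set K) k :
    finite_generating_system S -> ~ cayley_edge S k k.
  by move=> hS [s Ss /esym/(canRL (mulKg _))]; rewrite mulVg => s1;
     apply: (fgs_not1 hS); rewrite -s1.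
have [<-|gh] := pselect (g = h); first by split=> /loopless.
have fgh : f g <> f h by move=> /fI.
rewrite (graph_dist_edge R _ fgh) (graph_dist_edge R _ gh).
by have := fd g h; rewrite /cayley_dist => ->.
Qed.

Lemma isometric_rooted_iso (R : realType) (G L : groupType)
    (SG : set G) (SL : set L) :
  finite_generating_system SG -> finite_generating_system SL ->
  isometric_cayley_graphs R SG SL -> exists x : rooted_iso SG SL, True.
Proof.
move=> hG hL [f [[f' fK f'K] fd]].
have fI := can_inj fK.
have F1 : (f 1)^-1 * f 1 = 1 by rewrite mulVg.
have FI : injective (fun g => (f 1)^-1 * f g) by move=> g h /mulgI/fI.
have FS l : exists g, (f 1)^-1 * f g = l.
  by exists (f' (f 1 * l)); rewrite f'K mulKg.
have FE g h : cayley_edge SL ((f 1)^-1 * f g) ((f 1)^-1 * f h) <->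
    cayley_edge SG g h.
  by rewrite cayley_edgeM; exact: (isometry_edge hG hL fI fd).
by exists (RootedIso (fun _ _ => false) FI FS FE F1).
Qed.

(** * From orbit equivalence to isometry *)

Section OrbitMap.
Context (R : realType) (G : groupType) (S : set G).
Hypothesis hS : finite_generating_system S.
Context d (X : measurableType d) (mu : probability X R) (alpha : G -> X -> X).
Hypothesis act : pmp_action mu alpha.
Context (x : X).
Hypothesis free : stabilizer alpha x = [set 1].

(** The inverse is there because [alpha s] multiplies on the left, whereas edges
    of the Cayley graph are given by multiplication on the right. *)
Definition orbit_map g := alpha g^-1 x.

Lemma orbit_map1 : orbit_map 1 = x.
Proof. by rewrite /orbit_map invg1 (pmp_act1 act). Qed.

Lemma orbit_map_inj : injective orbit_map.
Proof.
move=> g h gh; have : stabilizer alpha x (h * g^-1).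
  rewrite /stabilizer /= (pmp_actM act) [alpha g^-1 x]gh -(pmp_actM act).
  by rewrite mulgV (pmp_act1 act).
by rewrite free => /divg1_eq.
Qed.

Lemma orbit_map_edge g y :
  orbit_edge S alpha (orbit_map g) y <->
  exists2 h, cayley_edge S g h & y = orbit_map h.
Proof.
split=> [[s Ss <-]|[_ [s Ss ->] ->]].
  exists (g * s^-1); first by exists s^-1 => //; exact: (fgs_symmetric hS).
  by rewrite /orbit_map invgM invgK (pmp_actM act).
exists s^-1; first exact: (fgs_symmetric hS).
by rewrite /orbit_map invgM (pmp_actM act).
Qed.

Lemma orbit_map_dist g h :
  orbit_dist S alpha (orbit_map g) (orbit_map h) = cayley_dist S g h :> \bar R.
Proof. exact/graph_dist_embedding/orbit_map_inj/orbit_map_edge. Qed.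

Lemma orbit_map_surj y : (orbit_dist (R := R) S alpha x y < +oo)%E ->
  exists g, orbit_map g = y.
Proof.
move=> /graph_dist_path[p]; rewrite -{1 2}orbit_map1 => pp lp.
have [q _ qE] := path_lift orbit_map_edge pp.
by exists (last 1 q); rewrite -lp qE last_map.
Qed.

End OrbitMap.

(** Orbits are sent to orbits because finite distances are sent to finite
    distances, and generating sets make Cayley graphs connected. *)
Lemma orbit_equivalent_isometric (R : realType) dX dY
    (X : measurableType dX) (Y : measurableType dY) (G L : groupType)
    (SG : set G) (SL : set L) (mu : probability X R) (nu : probability Y R)
    (alpha : G -> X -> X) (beta : L -> Y -> Y) :
  finite_generating_system SG -> finite_generating_system SL ->
  pmp_action mu alpha -> essentially_free mu alpha ->
  pmp_action nu beta -> essentially_free nu beta ->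
  isometric_orbit_equivalent SG SL mu nu alpha beta ->
  isometric_cayley_graphs R SG SL.
Proof.
move=> hG hL actA freeA actB freeB.
move=> [Phi [Psi [X0 [[PhiK PsiK] [mPhi _] Phi_nu [mX0 muX0 invA invB] dE]]]].
have freeB' : {ae mu, forall x, stabilizer beta (Phi x) = [set 1]}.
  case: freeB => N [mN N0 NP]; exists (Phi @^-1` N); split.
  - by rewrite -[X in measurable X]setTI; exact: mPhi.
  - by rewrite -N0 -Phi_nu.
  - by move=> x /= nx; exact: NP.
have aeX0 : {ae mu, forall x, X0 x}.
  exists (~` X0); split; [exact: measurableC| |by []].
  by rewrite probability_setC// muX0 subee.
have [x [[X0x fA] fB]] : exists x, (X0 x /\ stabilizer alpha x = [set 1]) /\
    stabilizer beta (Phi x) = [set 1].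
  have mu0 : (0 < mu setT)%E by rewrite probability_setT lte01.
  pose F := ae_properfilter_algebraOfSetsType mu0.
  exact: (@filter_ex _ _ F _ (filterI (filterI aeX0 freeA) freeB')).
pose phi := orbit_map alpha x; pose psi := orbit_map beta (Phi x).
have X0phi g : X0 (phi g) by rewrite -(invA g^-1); exists x.
have psiX0 l : (Phi @` X0) (psi l).
  by rewrite -(invB l^-1); exists (Phi x) => //; exists x.
have phi1 : phi 1 = x := orbit_map1 actA x.
have psi1 : psi 1 = Phi x := orbit_map1 actB (Phi x).
have exf g : exists l, psi l = Phi (phi g).
  apply: (orbit_map_surj (R := R) hL actB).
  rewrite dE// -[X in orbit_dist _ _ X _]phi1 (orbit_map_dist hG actA fA).
  exact: cayley_connected.
have exf' l : exists g, Phi (phi g) = psi l.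
  have [y X0y yE] := psiX0 l.
  suff [g gE] : exists g, phi g = y by exists g; rewrite gE.
  apply: (orbit_map_surj (R := R) hG actA).
  rewrite -dE// yE -psi1 (orbit_map_dist hL actB fB).
  exact: cayley_connected.
have [f fE] := choice exf; have [f' f'E] := choice exf'.
have psiI := orbit_map_inj actB fB; have phiI := orbit_map_inj actA fA.
exists f; split.
  exists f' => [g|l]; last by apply: psiI; rewrite -/psi fE f'E.
  by apply: phiI; apply: (can_inj PhiK); rewrite -/phi f'E fE.
move=> g h; rewrite -(orbit_map_dist hL actB fB) -(orbit_map_dist hG actA fA).
by rewrite -/phi -/psi !fE dE.
Qed.

(** * The equivalence *)

Theorem theorem1p2 (R : realType) (Gamma Lambda : groupType)
    (SGamma : set Gamma) (SLambda : set Lambda)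
    (hGamma : finite_generating_system SGamma)
    (hLambda : finite_generating_system SLambda) :
  (exists (dX dY : measure_display)
      (X : measurableType dX) (Y : measurableType dY)
      (mu : probability X R) (nu : probability Y R)
      (alpha : Gamma -> X -> X) (beta : Lambda -> Y -> Y),
    (standard_borel R X /\ standard_borel R Y) /\
    (pmp_action mu alpha /\ essentially_free mu alpha) /\
    (pmp_action nu beta /\ essentially_free nu beta) /\
    isometric_orbit_equivalent SGamma SLambda mu nu alpha beta)
  <-> isometric_cayley_graphs R SGamma SLambda.
Proof.
split.
  move=> [dX [dY [X [Y [mu [nu [alpha [beta]]]]]]]].
  move=> [_ [[actA freeA] [[actB freeB] oe]]].
  exact: (orbit_equivalent_isometric hGamma hLambda actA freeA actB freeB oe).
move=> /(isometric_rooted_iso hGamma hLambda)[x0 _].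
pose pX : pointedType :=
  HB.pack (rooted_iso SGamma SLambda) (isPointed.Build _ x0).
pose T := g_sigma_algebraType (@cylinders pX (@iso_agree _ _ SGamma SLambda)).
have [mu muE] := @exists_uniform pX _ (iso_tower hGamma hLambda) R.
have sT := @tower_standard_borel pX _ (iso_tower hGamma hLambda) R.
pose source := @source_action _ _ SGamma SLambda.
pose target := @target_action _ _ SGamma SLambda.
have free := reroot_free hGamma hLambda muE.
have act_source : pmp_action mu (source : Gamma -> T -> T).
  split.
  - by move=> x; rewrite /source /source_action invg1 reroot1.
  - exact: source_actionM.
  - by move=> g; have [] := reroot_preserved hGamma hLambda muE g^-1.
  - by move=> g; have [] := reroot_preserved hGamma hLambda muE g^-1.
have act_target : pmp_action mu (target : Lambda -> T -> T).
  split.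
  - exact: target_action1.
  - exact: target_actionM.
  - by move=> l; have [] := target_preserved hGamma hLambda muE l.
  - by move=> l; have [] := target_preserved hGamma hLambda muE l.
have free_source : essentially_free mu (source : Gamma -> T -> T).
  apply: (negligibleS _ free) => x; apply: contra_not => fx.
  apply/seteqP; split=> g /=.
    by move=> /fx; rewrite -{2}(invgK g) => ->; rewrite invg1.
  by move=> ->; exact: pmp_act1 act_source x.
have free_target : essentially_free mu (target : Lambda -> T -> T).
  apply: (negligibleS _ free) => x; apply: contra_not => fx.
  apply/seteqP; split=> l /=.
    move=> /fx g1; apply: invg_inj; rewrite invg1.
    by rewrite -(iso_invK x l^-1) g1 iso_fun1.
  by move=> ->; exact: pmp_act1 act_target x.
exists _, _, T, T, mu, mu, source, target.
do !split => //.
exists id, id, setT; split=> //.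
- split=> //.
  + exact: probability_setT.
  + move=> g; rewrite -subTset => x _; exists (source g^-1 x) => //.
    by rewrite -(pmp_actM act_source) mulgV (pmp_act1 act_source).
  + move=> l; rewrite image_id -subTset => x _; exists (target l^-1 x) => //.
    by rewrite -(pmp_actM act_target) mulgV (pmp_act1 act_target).
move=> x y _ _; rewrite /orbit_dist; congr (graph_dist _ x y).
apply/funext => u; apply/funext => v; apply/propext.
exact: orbit_edge_actions.
Qed.
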